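(* Let $a \in \mathbb{C}\setminus\{-1,-2,-3,\ldots\}$ and let $L_a:\omega\to\omega$ be the linear map on the space $\omega$ of all complex sequences $x=(x_n)_{n\ge 0}$ given by $$L_a(x)_n=\sum_{k=0}^n (-n)_k (n+a)_k\, x_k,\qquad n\ge 0.$$ Then $L_a$ is invertible, and for every $x\in\omega$: (a) if $a\in\mathbb{C}\setminus\{0,-1,-2,-3,\ldots\}$, $$L_a^{-1}(x)_n=\frac{1}{n!\,(1+a)_n}\sum_{k=0}^n \frac{(a)_k\left(1+\frac a2\right)_k(-n)_k}{k!\left(\frac a2\right)_k(1+a+n)_k}\,x_k,\qquad n\ge 0;$$ (b) if $a=0$, $$L_0^{-1}(x)_n=\frac{1}{(n!)^2}\left(-x_0+2\sum_{k=0}^n\frac{(-n)_k}{(1+n)_k}x_k\right),\qquad n\ge 0.$$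
   Context: For $\gamma\in\mathbb{C}$ and an integer $k\ge 0$, the rising factorial is $(\gamma)_0=1$ and $(\gamma)_k=\gamma(\gamma+1)\cdots(\gamma+k-1)$ for $k>0$. $\omega$ denotes the complex vector space of all sequences $(x_n)_{n=0}^\infty$ of complex numbers. *)

(* Defs.v *)
From HB Require Import structures.
From mathcomp Require Import all_boot all_order all_algebra.
From mathcomp Require Import boolp functions reals.
From mathcomp Require Import complex.

Set Implicit Arguments.
Unset Strict Implicit.
Unset Printing Implicit Defensive.

Import Order.TTheory GRing.Theory Num.Theory.
Local Open Scope ring_scope.
Local Open Scope complex_scope.

Definition rising (C : comPzRingType) (g : C) (k : nat) : C :=
  \prod_(i < k) (g + i%:R).

(* The complex numbers are R[i] for R : realType. *)
Definition omega (R : realType) : Type := nat -> R[i].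

HB.instance Definition _ (R : realType) :=
  GRing.Lmodule.copy (omega R) (nat -> R[i]^o).

Definition L (R : realType) (a : R[i]) (x : omega R) : omega R :=
  fun n => \sum_(k < n.+1) rising (- n%:R) k * rising (n%:R + a) k * x k.

Fact L_is_linear (R : realType) (a : R[i]) : linear (L a).
Proof.
move=> c x y; apply/funext => n.
rewrite /L !fctE /GRing.scale /= mulr_sumr -big_split /=.
by apply: eq_bigr => k _; rewrite mulrDr mulrCA.
Qed.

HB.instance Definition _ (R : realType) (a : R[i]) :=
  GRing.isLinear.Build R[i] (omega R) (omega R) *:%R (L a) (L_is_linear a).

(* Main.v *)
(* Over the common denominator (1+a)_{n-1}, the (n, j) entry of the product of
   L_a with the claimed inverse, for j < n, becomes the alternating binomial sum
   of order n - j of a polynomial of degree n - j - 1, hence vanishes.  Both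
   matrices are lower triangular, so the reverse product follows by truncating
   to finite matrices.  Writing (a)_k (1+a/2)_k / (a/2)_k as
   (1+a)_{k-1} (a+2k) for k > 0 treats a = 0 together with the other cases. *)
Require Import Defs.
From HB Require Import structures.
From mathcomp Require Import all_boot all_order all_algebra.
From mathcomp Require Import boolp functions reals.
From mathcomp Require Import complex.
From mathcomp Require Import ring zify.

Set Implicit Arguments.
Unset Strict Implicit.
Unset Printing Implicit Defensive.

Import Order.TTheory GRing.Theory Num.Theory.
Local Open Scope ring_scope.
Local Open Scope complex_scope.

(** * Rising factorials and alternating binomial sums *)

Section RisingFactorial.
Variable C : comPzRingType.
Implicit Type g : C.

Lemma rising0 g : rising g 0 = 1.
Proof. exact: big_ord0. Qed.

Lemma risingSr g k : rising g k.+1 = rising g k * (g + k%:R).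
Proof. exact: big_ord_recr. Qed.

Lemma risingD g m k : rising g (m + k) = rising g m * rising (g + m%:R) k.
Proof.
rewrite /rising big_split_ord; congr (_ * _).
by apply: eq_bigr => i _ /=; rewrite natrD addrA.
Qed.

Lemma risingSl g k : rising g k.+1 = g * rising (g + 1) k.
Proof. by rewrite -add1n risingD risingSr rising0 mul1r addr0. Qed.

(** Both terms share the factor $(g+1)_k$; the leftover factors $g$ and $g+1+k$ differ by $-(k+1)$.
    So differencing lowers the degree by one. *)
Lemma rising_shiftB g k :
  rising g k.+1 - rising (g + 1) k.+1 = - k.+1%:R * rising (g + 1) k.
Proof. rewrite risingSl risingSr -(natr1 k); ring. Qed.

Lemma risingNn n k : rising (- n%:R : C) k = (-1) ^+ k * (n ^_ k)%:R.
Proof.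
elim: k => [|k IHk]; first by rewrite rising0 mul1r.
rewrite risingSr IHk ffactnSr exprS; have [le_kn|lt_nk] := leqP k n.
  by rewrite natrM (natrB _ le_kn); ring.
by rewrite ffact_small // mul0n !mulr0 mul0r.
Qed.

(** Pascal's rule splits the sum in two, and an index shift in one half pairs $f(i)$ with
    $f(i+1)$. *)
Lemma alt_bin_sumS m (f : nat -> C) :
  \sum_(i < m.+2) (-1) ^+ i * 'C(m.+1, i)%:R * f i =
  \sum_(i < m.+1) (-1) ^+ i * 'C(m, i)%:R * (f i - f i.+1).
Proof.
rewrite big_ord_recl bin0.
under eq_bigr do rewrite /= /bump /= add1n binS natrD mulrDr mulrDl.
under [RHS]eq_bigr do rewrite mulrBr.
rewrite big_split sumrB /= addrA; congr (_ + _); last first.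
  by rewrite -sumrN; apply: eq_bigr => i _; rewrite exprS; ring.
rewrite big_ord_recr /= bin_small // mulr0 mul0r addr0.
by rewrite [RHS]big_ord_recl bin0.
Qed.

(** Each differencing step lowers both $m$ and $r$ by one and moves $g$ to $g+1$, until a constant
    is differenced. *)
Lemma alt_bin_sum_rising m r g : (r < m)%N ->
  \sum_(i < m.+1) (-1) ^+ i * 'C(m, i)%:R * rising (g + i%:R) r = 0.
Proof.
elim: m r g => [|m IHm] [|r] g //= lt_rm.
  rewrite (alt_bin_sumS _ (fun i => rising (g + i%:R) 0)) big1 // => i _.
  by rewrite !rising0 subrr mulr0.
rewrite (alt_bin_sumS _ (fun i => rising (g + i%:R) r.+1)).
transitivity (- r.+1%:R * \sum_(i < m.+1)
    (-1) ^+ i * 'C(m, i)%:R * rising (g + 1 + i%:R) r); last first.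
  by rewrite IHm ?mulr0.
rewrite mulr_sumr; apply: eq_bigr => i _.
by rewrite -(natr1 i) addrA rising_shiftB (addrAC g 1); ring.
Qed.

End RisingFactorial.

(** * The two triangular matrices and their products *)

Section Inversion.
Variables (F : numFieldType) (a : F).
Hypothesis ha : forall m : nat, a <> - m.+1%:R.

Definition fwd_coef n k : F := rising (- n%:R) k * rising (n%:R + a) k.

(* Extends [(a)_k (1 + a/2)_k / (a/2)_k] by continuity to [a = 0]. *)
Definition weight k : F :=
  if k is k'.+1 then rising (1 + a) k' * (a + 2 * k%:R) else 1.

(** The factors $(1+a)_n(1+a+n)_k$ of the stated formula are merged into $(1+a)_{n+k}$. *)
Definition inv_coef n k : F :=
  weight k * rising (- n%:R) k / (k`!%:R * n`!%:R * rising (1 + a) (n + k)).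

Lemma addr_nat_neq0 k : a + k.+1%:R != 0.
Proof. by rewrite addr_eq0; apply/eqP/ha. Qed.

Lemma rising_neq0 k : rising (1 + a) k != 0.
Proof.
apply/prodf_neq0 => i _.
by rewrite addrAC addrC nat1r addr_nat_neq0.
Qed.

Lemma fact_neq0 k : k`!%:R != 0 :> F.
Proof. by rewrite pnatr_eq0 -lt0n fact_gt0. Qed.

Lemma fwd_coef_small n k : (n < k)%N -> fwd_coef n k = 0.
Proof. by move=> nk; rewrite /fwd_coef risingNn ffact_small // mulr0 mul0r. Qed.

Lemma inv_coef_small n k : (n < k)%N -> inv_coef n k = 0.
Proof.
by move=> nk; rewrite /inv_coef risingNn ffact_small // !(mulr0, mul0r).
Qed.

(** For $n>0$ the factors of $(1+a)_{n-1}$, then of $(n+a)_n$, then $a+2n$ are consecutive. This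
    settles the diagonal entries of the product. *)
Lemma weight_rising n :
  weight n * rising (n%:R + a) n = rising (1 + a) (n + n).
Proof.
case: n => [|n] /=; first by rewrite !rising0 mulr1.
have -> : (n.+1 + n.+1 = (n + n.+1).+1)%N by [].
rewrite [RHS]risingSr risingD.
rewrite (_ : 1 + a + n%:R = n.+1%:R + a); last by rewrite -natr1; ring.
by rewrite natrD -(natr1 n); ring.
Qed.

(** Written with factorials, the falling factorials regroup into $\binom{j+m}{j}\binom{m}{i}$, and
    the signs multiply to $(-1)^i$. *)
Lemma fwd_inv_term j m i : (i <= m)%N ->
  fwd_coef (j + m) (j + i) * inv_coef (j + i) j =
  weight j * 'C(j + m, j)%:R * ((-1) ^+ i * 'C(m, i)%:R *
    (rising ((j + m)%:R + a) (j + i) / rising (1 + a) (j + j + i))).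
Proof.
move=> le_im; rewrite /fwd_coef /inv_coef !risingNn.
have f1 : ((j + m) ^_ (j + i))%:R = (j + m)`!%:R / (m - i)`!%:R :> F.
  apply: (canRL (mulfK (fact_neq0 _))).
  by rewrite -natrM -(subnDl j m i) ffact_fact // leq_add2l.
have f2 : ((j + i) ^_ j)%:R = (j + i)`!%:R / i`!%:R :> F.
  apply: (canRL (mulfK (fact_neq0 _))).
  by rewrite -natrM -{2}(addKn j i) ffact_fact // leq_addr.
have f3 : 'C(j + m, j)%:R = (j + m)`!%:R / (j`!%:R * m`!%:R) :> F.
  apply: (canRL (mulfK _)); first by rewrite mulf_neq0 ?fact_neq0.
  by rewrite -!natrM -{2}(addKn j m) bin_fact // leq_addr.
have f4 : 'C(m, i)%:R = m`!%:R / (i`!%:R * (m - i)`!%:R) :> F.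
  apply: (canRL (mulfK _)); first by rewrite mulf_neq0 ?fact_neq0.
  by rewrite -!natrM bin_fact.
have s : (-1) ^+ (j + i) * (-1) ^+ j = (-1) ^+ i :> F.
  by rewrite exprD mulrAC -expr2 sqrr_sign mul1r.
rewrite f1 f2 f3 f4 -s -(addnA j j i) (addnC j (j + i)).
have := rising_neq0 (j + i + j).
have := (fact_neq0 j, fact_neq0 m, fact_neq0 i, fact_neq0 (j + i), fact_neq0 (m - i)).
by move=> [[[[? ?] ?] ?] ?] ?; field; do ?[apply/andP; split].
Qed.

Lemma fwd_inv_coef n j :
  \sum_(k < n.+1) fwd_coef n k * inv_coef k j = (n == j)%:R.
Proof.
have [lt_nj|le_jn] := ltnP n j.
  rewrite (ltn_eqF lt_nj) big1 // => k _.
  by rewrite [inv_coef _ _]inv_coef_small ?mulr0 // (leq_trans (ltn_ord k)).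
(* Set $n=j+m$; the terms with $k<j$ vanish, and the others are indexed by $k=j+i$. *)
rewrite -(subnKC le_jn); move: (n - j)%N => m {n le_jn}.
rewrite -addnS big_split_ord /= big1 ?add0r; last first.
  by move=> k _; rewrite [inv_coef _ _]inv_coef_small ?mulr0.
under eq_bigr => i _ do rewrite fwd_inv_term -1?ltnS ?ltn_ord //.
rewrite -mulr_sumr; case: m => [|m].
  rewrite big_ord1 !addn0 bin0 binn eqxx !mulr1 expr0 !mul1r mulrA.
  by rewrite weight_rising divff ?rising_neq0.
have /negPf-> : (j + m.+1)%N != j by lia.
(* Over [(1+a)_(j+m)], the ratio of rising factorials is a polynomial of
   degree [m] in [i], which the alternating sum of order [m + 1] kills. *)
have ratio i : rising ((j + m.+1)%:R + a) (j + i) / rising (1 + a) (j + j + i)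
    = rising (1 + a + (j + j)%:R + i%:R) m / rising (1 + a) (j + m).
  apply/eqP; rewrite eqr_div ?rising_neq0 //; apply/eqP.
  (* Cross-multiplied, both sides equal $(1+a)_{2j+m+i}$. *)
  rewrite [RHS]mulrC -addrA -natrD -risingD mulrC.
  rewrite (_ : (j + m.+1)%:R + a = 1 + a + (j + m)%:R); last first.
    by rewrite addnS -natr1; ring.
  by rewrite -risingD; congr rising; lia.
under eq_bigr do rewrite ratio mulrA.
by rewrite -mulr_suml alt_bin_sum_rising // mul0r mulr0.
Qed.

(* On finite truncations a one-sided inverse is two-sided. *)
Lemma inv_fwd_coef n j :
  \sum_(k < n.+1) inv_coef n k * fwd_coef k j = (n == j)%:R.
Proof.
have [lt_nj|le_jn] := ltnP n j.
  rewrite (ltn_eqF lt_nj) big1 // => k _.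
  by rewrite [fwd_coef _ _]fwd_coef_small ?mulr0 // (leq_trans (ltn_ord k)).
pose A := \matrix_(i < n.+1, k < n.+1) fwd_coef i k.
pose B := \matrix_(i < n.+1, k < n.+1) inv_coef i k.
have AB : A *m B = 1%:M.
  apply/matrixP => i k; rewrite !mxE -val_eqE /= -fwd_inv_coef.
  under eq_bigr do rewrite !mxE.
  (* The matrix product sums up to $n$, but the terms beyond $i$ vanish by triangularity. *)
  rewrite (big_ord_widen_cond _ xpredT
    (fun l => fwd_coef i l * inv_coef l k) (ltn_ord i)) big_mkcond /=.
  rewrite [RHS]big_mkcond; apply: eq_bigr => l _.
  by rewrite ltnS; case: leqP => // il; rewrite fwd_coef_small ?mul0r.
have lt_jn : (j < n.+1)%N by [].
(* Row $n$ is the last row of the truncation. *)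
have /matrixP/(_ ord_max (Ordinal lt_jn)) := mulmx1C AB.
rewrite !mxE -val_eqE /= => <-.
by apply: eq_bigr => k _; rewrite !mxE.
Qed.

End Inversion.

(** * Composition of triangular maps and closed forms of the inverse *)

Lemma tri_sum_comp (F : fieldType) (A B : nat -> nat -> F) (x : nat -> F) n :
  (forall i k, (i < k)%N -> B i k = 0) ->
  (forall j, \sum_(k < n.+1) A n k * B k j = (n == j)%:R) ->
  \sum_(k < n.+1) A n k * (\sum_(j < k.+1) B k j * x j) = x n.
Proof.
move=> B0 AB.
(* Triangularity of [B] extends every inner sum up to $n$, so the two sums can be exchanged. *)
transitivity (\sum_(j < n.+1) \sum_(k < n.+1) A n k * B k j * x j).
  rewrite exchange_big; apply: eq_bigr => k _ /=.
  rewrite (big_ord_widen_cond _ xpredT (fun j => B k j * x j) (ltn_ord k)).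
  rewrite mulr_sumr big_mkcond; apply: eq_bigr => j _ /=.
  by rewrite ltnS mulrA; case: leqP => // kj; rewrite B0 // mulr0 mul0r.
under eq_bigr do rewrite -mulr_suml AB.
rewrite big_ord_recr /= eqxx mul1r big1 ?add0r // => j _.
by rewrite gtn_eqF // mul0r.
Qed.

(** For $k>0$, $(1+a/2)_k/(a/2)_k$ telescopes to $(a+2k)/a$, and $a$ cancels the first factor of
    $(a)_k$. *)
Lemma inv_coefE (F : numFieldType) (a : F) n k :
    (forall m : nat, a <> - m%:R) ->
  inv_coef a n k = (n`!%:R * rising (1 + a) n)^-1 *
    ((rising a k * rising (1 + a / 2) k * rising (- n%:R) k) /
     (k`!%:R * rising (a / 2) k * rising (1 + a + n%:R) k)).
Proof.
move=> ha.
have a20 m : a / 2 + m%:R != 0.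
  (* A zero factor $a/2+m$ would give $a=-2m$. *)
  apply/eqP => e; apply: (ha (2 * m)%N); rewrite natrM -[LHS]subr0 -(mulr0 2) -e.
  by field.
have r20 m : rising (a / 2) m != 0 by apply/prodf_neq0 => i _.
have a0 : a != 0 by apply/eqP => e; apply: (ha 0%N); rewrite e oppr0.
have wE : weight a k = rising a k * rising (1 + a / 2) k / rising (a / 2) k.
  apply: (canRL (mulfK (r20 k))); case: k => [|k] /=.
    by rewrite !rising0 mulr1.
  rewrite risingSl [in RHS](risingSl a) (risingSr (1 + _)) ![_ + 1]addrC -natr1.
  by field.
rewrite /inv_coef wE.
have ha' (m : nat) : a <> - m.+1%:R by exact: ha.
have := (rising_neq0 ha' n, rising_neq0 ha' (n + k)); rewrite risingD.
rewrite mulf_eq0 negb_or => -[? /andP[? ?]].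
by field; rewrite !fact_neq0 r20; do ?[apply/andP; split].
Qed.

Lemma rising1 (C : comPzRingType) k : rising (1 : C) k = k`!%:R.
Proof.
elim: k => [|k IHk]; first exact: rising0.
by rewrite risingSr IHk nat1r -natrM factS mulnC.
Qed.

(** At $a=0$ the weight is $2\,k!$ for $k>0$ but only $1$ for $k=0$; this deficit becomes the
    isolated $-x_0$ in (b). *)
Lemma inv_coef0E (F : numFieldType) n k :
  inv_coef (0 : F) n k = (n`!%:R ^+ 2)^-1 *
    ((2 - (k == 0%N)%:R) * (rising (- n%:R) k / rising (1 + n%:R) k)).
Proof.
have h0 (m : nat) : (0 : F) <> - m.+1%:R.
  by apply/eqP; rewrite eq_sym oppr_eq0 pnatr_eq0.
have wE : weight 0 k = (2 - (k == 0%N)%:R) * k`!%:R :> F.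
  case: k => [|k]; first by rewrite eqxx -[2](natr1 1) addrK mulr1.
  by rewrite /= addr0 rising1 factS natrM; ring.
have := rising_neq0 h0 (n + k).
rewrite /inv_coef wE addr0 risingD rising1 mulf_eq0 negb_or => /andP[? ?].
by field; rewrite !fact_neq0; do ?[apply/andP; split].
Qed.

Lemma sum_inv_coef0 (F : numFieldType) (a : F) (x : nat -> F) n : a = 0 ->
  \sum_(k < n.+1) inv_coef a n k * x k = (n`!%:R ^+ 2)^-1 *
    (- x 0%N + 2 * \sum_(k < n.+1) rising (- n%:R) k / rising (1 + n%:R) k * x k).
Proof.
move=> ->; under eq_bigr do rewrite inv_coef0E -mulrA.
rewrite -mulr_sumr !big_ord_recl /= !rising0; congr (_ * _).
rewrite mulrDr addrA mulr_sumr; congr (_ + _).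
  by rewrite -[2](natr1 1) addrK invr1; ring.
by apply: eq_bigr => k _; rewrite /= subr0 mulrA.
Qed.

(** * The inverse operator on sequences *)

Definition invL (R : realType) (a : R[i]) (x : omega R) : omega R :=
  fun n => \sum_(k < n.+1) inv_coef a n k * x k.

Fact invL_is_linear (R : realType) (a : R[i]) : linear (invL a).
Proof.
move=> c x y; apply/funext => n.
rewrite /invL !fctE /GRing.scale /= mulr_sumr -big_split /=.
by apply: eq_bigr => k _; rewrite mulrDr mulrCA.
Qed.

HB.instance Definition _ (R : realType) (a : R[i]) :=
  GRing.isLinear.Build R[i] (omega R) (omega R) *:%R (invL a) (invL_is_linear a).

Theorem theorem3p1 (R : realType) (a : R[i])
    (ha : forall m : nat, a <> - m.+1%:R) :
  exists Linv : {linear omega R -> omega R},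
    [/\ cancel (L a) Linv,
        cancel Linv (L a),
        (forall m : nat, a <> - m%:R) ->
          forall (x : omega R) (n : nat),
            Linv x n = (n`!%:R * rising (1 + a) n)^-1 *
              \sum_(k < n.+1)
                (rising a k * rising (1 + a / 2) k * rising (- n%:R) k) /
                (k`!%:R * rising (a / 2) k * rising (1 + a + n%:R) k) * x k
      & a = 0 ->
          forall (x : omega R) (n : nat),
            Linv x n = (n`!%:R ^+ 2)^-1 *
              (- x 0%N + 2 * \sum_(k < n.+1)
                 rising (- n%:R) k / rising (1 + n%:R) k * x k)].
Proof.
exists (invL a); split => [x|x|ha0 x n|a0 x n].
- apply/funext => n; apply: (@tri_sum_comp _ (inv_coef a) (fwd_coef a)) => [i k|j].
    exact: fwd_coef_small.
  exact: inv_fwd_coef.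
- apply/funext => n; apply: (@tri_sum_comp _ (fwd_coef a) (inv_coef a)) => [i k|j].
    exact: inv_coef_small.
  exact: fwd_inv_coef.
- rewrite /= /invL mulr_sumr; apply: eq_bigr => k _.
  by rewrite (inv_coefE _ _ ha0) -!mulrA.
exact: sum_inv_coef0.
Qed.
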